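(* Suppose the cost distributions $\mathcal{C}_1,\dots,\mathcal{C}_n$ are regular, and for each $i$ let $\overline{p}_i\in\arg\max_{p'}\lambda_i(p')$, $\overline{\mathbf{p}}=(\overline{p}_1,\dots,\overline{p}_n)$. Consider the mechanism VWM-PIA: given reports $(\mathbf{c}',\mathbf{p})$, the slot is allocated so as to maximize $\sum_{i\in N}\phi_i(c_i',\overline{p}_i)\pi_i(\mathbf{c}',\mathbf{p})$ (ties broken arbitrarily); losers pay $0$; the winner $i$ pays $v_i\big(\phi_i^{-1}(\max\{\phi^{(2)}(\mathbf{c}',\overline{\mathbf{p}}),0\},\overline{p}_i),p_i\big)$, where $\phi_i^{-1}(\cdot,\overline{p}_i)$ is the inverse of $c\mapsto\phi_i(c,\overline{p}_i)$ and $\phi^{(2)}(\mathbf{c}',\overline{\mathbf{p}})$ is the second highest of $\phi_j(c_j',\overline{p}_j)$, $j\in N$. Then VWM-PIA is incentive compatible and individually rational, and its expected revenue $\mathrm{E}_{\mathbf{c}\sim\mathcal{C}}[\sum_i x_i(\mathbf{c},\overline{\mathbf{p}})]$ at the equilibrium prices $\overline{\mathbf{p}}$ is maximal among all incentive compatible and individually rational mechanisms with a price-independent allocation policy whose payments satisfy $x_i(c_i,\mathbf{c}_{-i},\mathbf{p})=v_i(c_i,p_i)\pi_i(c_i,\mathbf{c}_{-i},\mathbf{p})-\lambda_i(p_i)\int_{c_i}^{\overline{c}_i}\pi_i(z,\mathbf{c}_{-i},\mathbf{p})\,dz$ (for which $\overline{\mathbf{p}}$ is likewise the dominant-strategy price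 profile).
   Context: There are advertisers $N=\{1,\dots,n\}$ competing for a single ad slot. Advertiser $i$ has a private product cost $c_i\in[\underline{c}_i,\overline{c}_i]$; costs are independent, $c_i$ with CDF $\mathcal{C}_i$ and density $\mathcal{C}_i'$; $\mathcal{C}$ is the joint distribution. Advertiser $i$ sets a display price $p_i$, has conversion-rate function $\lambda_i:\mathbb{R}\to(0,1]$ and value $v_i(c_i,p_i)=(p_i-c_i)\lambda_i(p_i)$. Virtual value: $\phi_i(c_i,p_i)=v_i(c_i,p_i)-\lambda_i(p_i)\mathcal{C}_i(c_i)/\mathcal{C}_i'(c_i)$; $\mathcal{C}_i$ is regular if $\phi_i(c_i,p_i)$ is non-increasing in $c_i$ for every $p_i$. An auction mechanism maps cost reports and display prices $(\mathbf{c}',\mathbf{p})$ to allocations $\pi_i(\mathbf{c}',\mathbf{p})\in\{0,1\}$ (at most one winner) and payments $x_i(\mathbf{c}',\mathbf{p})$; utility $u_i=v_i(c_i,p_i)\pi_i-x_i$. IC: truthful cost reporting maximizes $u_i$ for all $i$, true costs, prices and others' reports. IR: truthful cost reporting yields $u_i\ge0$. The allocation policy is price-independent if $\pi_i(\mathbf{c}',\mathbf{p}^1)=\pi_i(\mathbf{c}',\mathbf{p}^2)$ for all $i,\mathbf{c}',\mathbf{p}^1,\mathbf{p}^2$.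
   Formalization: The virtual value at the price maximizing the conversion rate is assumed injective in the cost (so its inverse exists; regularity alone allows flat parts), the density is assumed positive on the whole cost interval, and allocations are assumed measurable. *)

(* Defs.v *)
From HB Require Import structures.
From mathcomp Require Import all_boot all_order all_algebra.
From mathcomp Require Import all_classical all_reals all_analysis.
Set Implicit Arguments. Unset Strict Implicit. Unset Printing Implicit Defensive.
Import Order.TTheory GRing.Theory Num.Theory.
Local Open Scope classical_set_scope.
Local Open Scope ring_scope.

Section Auction.
Variables (R : realType) (n : nat).

Definition profile := 'I_n -> R.

Definition upd (c : profile) (i : 'I_n) (z : R) : profile :=
  fun j => if j == i then z else c j.

Definition in_costs (lo hi : profile) (c : profile) : Prop :=
  forall i, lo i <= c i <= hi i.

Definition value (lam : 'I_n -> R -> R) (i : 'I_n) (ci pi : R) : R :=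
  (pi - ci) * lam i pi.

Definition vvalue (lam C dens : 'I_n -> R -> R) (i : 'I_n) (ci pi : R) : R :=
  value lam i ci pi - lam i pi * C i ci / dens i ci.

Definition regular (lo hi : profile) (lam C dens : 'I_n -> R -> R) (i : 'I_n) : Prop :=
  forall p x y, lo i <= x -> x <= y -> y <= hi i ->
    vvalue lam C dens i y p <= vvalue lam C dens i x p.

Definition is_density (lo hi : profile) (C dens : 'I_n -> R -> R) (i : 'I_n) : Prop :=
  [/\ measurable_fun setT (dens i),
      (forall z, lo i <= z <= hi i -> 0 < dens i z),
      (forall z, z < lo i \/ hi i < z -> dens i z = 0) &
      (forall x, ((C i x)%:E = \int[lebesgue_measure]_(z in `]-oo, x]) (dens i z)%:E)%E)].

Definition indep_costs d (T : measurableType d) (P : probability T R)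
  (c : 'I_n -> T -> R) : Prop :=
  forall B : 'I_n -> set R, (forall i, measurable (B i)) ->
    P (\bigcap_(i in [set: 'I_n]) (c i @^-1` B i)) =
    (\prod_(i < n) P (c i @^-1` B i))%E.

Definition cylinders : set (set profile) :=
  [set A | exists B : 'I_n -> set R, (forall i, measurable (B i)) /\
           A = [set x | forall i, B i (x i)]].

Definition prod_measurable (F : profile -> R) : Prop :=
  forall A : set R, measurable A -> <<s cylinders >> (F @^-1` A).

Definition feasible (a : profile) : Prop :=
  (forall i, a i = 0 \/ a i = 1) /\ \sum_(i < n) a i <= 1.

Definition is_allocation (alloc : profile -> profile -> profile) : Prop :=
  forall c p, feasible (alloc c p).

Definition utility (lam : 'I_n -> R -> R) (alloc pay : profile -> profile -> profile)
  (i : 'I_n) (ci : R) (c' p : profile) : R :=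
  value lam i ci (p i) * alloc c' p i - pay c' p i.

Definition IC (lo hi : profile) (lam : 'I_n -> R -> R)
  (alloc pay : profile -> profile -> profile) : Prop :=
  forall i (c p : profile) (ci' : R), in_costs lo hi c -> lo i <= ci' <= hi i ->
    utility lam alloc pay i (c i) (upd c i ci') p <= utility lam alloc pay i (c i) c p.

Definition IR (lo hi : profile) (lam : 'I_n -> R -> R)
  (alloc pay : profile -> profile -> profile) : Prop :=
  forall i (c p : profile), in_costs lo hi c -> 0 <= utility lam alloc pay i (c i) c p.

Definition price_independent (alloc : profile -> profile -> profile) : Prop :=
  forall c p1 p2 i, alloc c p1 i = alloc c p2 i.

Definition payment_rule (lo hi : profile) (lam : 'I_n -> R -> R)
  (alloc pay : profile -> profile -> profile) : Prop :=
  forall i (c p : profile), in_costs lo hi c ->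
    pay c p i = value lam i (c i) (p i) * alloc c p i
      - lam i (p i) * \int[lebesgue_measure]_(z in `[c i, hi i]) alloc (upd c i z) p i.

Definition dominant_prices (lo hi : profile) (lam : 'I_n -> R -> R)
  (alloc pay : profile -> profile -> profile) (pbar : profile) : Prop :=
  forall i (c p : profile) (q : R), in_costs lo hi c ->
    utility lam alloc pay i (c i) c (upd p i q)
      <= utility lam alloc pay i (c i) c (upd p i (pbar i)).

(* second highest of the numbers phi_j, j in N (0 if n < 2; only used through max(.,0)) *)
Definition second_highest (phi : profile) : R :=
  nth 0 (sort (fun x y => y <= x) [seq phi j | j <- enum 'I_n]) 1.

(* phi_i^{-1}(y, pbar_i): the cost c in [lo_i,hi_i] with phi_i(c,pbar_i) = y,
   written as sup{c in [lo_i,hi_i] | phi_i(c,pbar_i) >= y} (agrees with the inverse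
   on the range of phi_i(.,pbar_i), which is strictly decreasing) *)
Definition vv_inv (lo hi : profile) (lam C dens : 'I_n -> R -> R) (i : 'I_n) (q y : R) : R :=
  sup [set z | lo i <= z <= hi i /\ y <= vvalue lam C dens i z q].

Definition vwm_allocation (lo hi : profile) (lam C dens : 'I_n -> R -> R)
  (pbar : profile) (alloc : profile -> profile -> profile) : Prop :=
  is_allocation alloc /\
  forall c p, in_costs lo hi c -> forall a, feasible a ->
    \sum_(j < n) vvalue lam C dens j (c j) (pbar j) * a j
      <= \sum_(j < n) vvalue lam C dens j (c j) (pbar j) * alloc c p j.

Definition vwm_payment (lo hi : profile) (lam C dens : 'I_n -> R -> R)
  (pbar : profile) (alloc : profile -> profile -> profile) : profile -> profile -> profile :=
  fun c p i => alloc c p i *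
    value lam i
      (vv_inv lo hi lam C dens i (pbar i)
         (Num.max (second_highest (fun j => vvalue lam C dens j (c j) (pbar j))) 0))
      (p i).

Definition exp_revenue d (T : measurableType d) (P : probability T R)
  (c : 'I_n -> T -> R) (pay : profile -> profile -> profile) (pbar : profile) : \bar R :=
  (\int[P]_w (\sum_(i < n) pay (fun j => c j w) pbar i)%:E)%E.

End Auction.

(* Main.v *)
Require Import Defs.
From HB Require Import structures.
From mathcomp Require Import all_boot all_order all_algebra.
From mathcomp Require Import all_classical all_reals all_analysis.
From mathcomp Require Import measurable_realfun.
From mathcomp Require Import lra ring.
Set Implicit Arguments. Unset Strict Implicit. Unset Printing Implicit Defensive.
Import Order.TTheory GRing.Theory Num.Theory.
Local Open Scope classical_set_scope.
Local Open Scope ring_scope.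

(** Winning with virtual value [phi_i] forces every rival virtual value and [0]
    below [phi_i], so the winner's payment is the value at the threshold cost
    [zstar], which does not depend on the own report: the utility of [i] is
    [alloc * (zstar - c_i) * lam_i p_i].  Incentive compatibility, individual
    rationality and dominance of [pbar] follow, and the allocation, as a function
    of the own report, is the indicator of an interval ending at [zstar], so
    VWM-PIA itself obeys the integral payment formula.

    Under that formula the expected payment of [i] is the expected virtual value
    of its allocation (Myerson): by independence the joint law of the costs is
    unchanged if [c_i] is resampled from its own law, and Tonelli's theorem
    turns the expected rent [lam_i * \int_(c_i)^(hi_i) alloc] into the
    expectation of [lam_i * C_i / C_i' * alloc].  VWM-PIA maximizes the virtual
    surplus pointwise, hence in expectation. *)

(** * Replacing one coordinate of a profile *)

Section Updates.
Variables (R : realType) (n : nat).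
Implicit Types (c : 'I_n -> R) (i : 'I_n).

Lemma upd_id c i : upd c i (c i) = c.
Proof. by apply/funext => j; rewrite /upd; case: eqVneq => // ->. Qed.

Lemma upd_same c i z : upd c i z i = z.
Proof. by rewrite /upd eqxx. Qed.

Lemma upd_neq c i j z : j != i -> upd c i z j = c j.
Proof. by rewrite /upd => /negbTE ->. Qed.

Lemma upd_upd c i y z : upd (upd c i y) i z = upd c i z.
Proof. by apply/funext => j; rewrite /upd; case: eqP. Qed.

Lemma in_costs_upd (lo hi : 'I_n -> R) c i z :
  in_costs lo hi c -> lo i <= z <= hi i -> in_costs lo hi (upd c i z).
Proof. by move=> cb zb j; rewrite /upd; case: eqP => // ->. Qed.

End Updates.

(** * Optimal allocations: the winner against its strongest rival *)

Section Winner.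
Variables (R : realType) (n : nat).
Implicit Types (a phi : 'I_n -> R) (i : 'I_n).

Lemma feasible_ge0 a i : feasible a -> 0 <= a i.
Proof. by move=> [/(_ i) [] -> _]. Qed.

Lemma feasible_le1 a i : feasible a -> a i <= 1.
Proof. by move=> [/(_ i) [] -> _]. Qed.

Lemma feasible0 : @feasible R n (fun=> 0).
Proof. by split; [left|rewrite big1]. Qed.

Lemma feasible_delta i : @feasible R n (fun j => (j == i)%:R).
Proof.
split=> [j|]; first by case: eqP; [right|left].
by rewrite (bigD1 i)//= eqxx big1 ?addr0// => j /negbTE ->.
Qed.

Lemma sum_delta phi i : \sum_(j < n) phi j * (j == i)%:R = phi i.
Proof.
by rewrite (bigD1 i)//= eqxx mulr1 big1 ?addr0// => j /negbTE ->; rewrite mulr0.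
Qed.

Lemma feasible_winner a i j : feasible a -> a i = 1 -> j != i -> a j = 0.
Proof.
move=> fa ai ji; case: (fa) => _; rewrite (bigD1 i)//= ai gerDl (bigD1 j)//= => H.
apply/eqP; rewrite eq_le feasible_ge0// andbT; apply: le_trans H.
by rewrite lerDl sumr_ge0// => k _; exact: feasible_ge0.
Qed.

(** The value that [i] has to beat; the base [0] of the maximum stands for leaving the slot
    empty. *)
Definition rival (phi : 'I_n -> R) i : R := \big[Num.max/0]_(j < n | j != i) phi j.

Lemma rival_ge0 phi i : 0 <= rival phi i.
Proof. exact: bigmax_ge_id. Qed.

Lemma rival_ge phi i j : j != i -> phi j <= rival phi i.
Proof. by move=> ji; exact: le_bigmax_cond. Qed.

Lemma eq_rival (phi psi : 'I_n -> R) i :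
  (forall j, j != i -> phi j = psi j) -> rival phi i = rival psi i.
Proof. by move=> e; apply: eq_bigr. Qed.

Let geR := (fun x y : R => y <= x).

(** The head of a decreasing list is its maximum; the default [0] for the empty list agrees with the
    base of the big maximum. *)
Lemma max_nth0_sorted (s : seq R) : sorted geR s ->
  Num.max (nth 0 s 0) 0 = \big[Num.max/0]_(x <- s) x.
Proof.
case: s => [_|y s /= sy]; first by rewrite big_nil maxxx.
rewrite big_cons; have ys : all (fun x => x <= y) s.
  by apply: order_path_min sy => a b c ba cb; exact: le_trans cb ba.
apply/eqP; rewrite eq_le; apply/andP; split.
  by rewrite ge_max !le_max lexx/= bigmax_ge_id orbT.
rewrite ge_max le_max lexx/=; elim: s {sy} ys => [_|x s IH /= /andP[xy /IH H]].
  by rewrite big_nil le_max lexx orbT.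
by rewrite big_cons ge_max H le_max xy.
Qed.

(** Sorting puts [phi i] in front of the sorted values of the others, ties included, so index 1 of
    the whole list is index 0 of the rest. *)
Lemma second_highest_rival phi i : (forall j, phi j <= phi i) ->
  Num.max (second_highest phi) 0 = rival phi i.
Proof.
move=> top; rewrite /second_highest -/geR.
have geT : total geR by move=> x y; rewrite /geR le_total.
have geTr : transitive geR by move=> x y z yx xz; exact: le_trans xz yx.
have geA : antisymmetric geR by move=> x y /andP[? ?]; apply/le_anti/andP.
have pe : perm_eq (enum 'I_n) (i :: rem i (enum 'I_n)).
  by apply: perm_to_rem; rewrite mem_enum.
pose r := [seq phi j | j <- rem i (enum 'I_n)].
have -> : sort geR [seq phi j | j <- enum 'I_n] = phi i :: sort geR r.
  apply: (sorted_eq geTr geA); first exact: sort_sorted.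
    rewrite /= path_min_sorted ?sort_sorted//.
    by rewrite all_sort; apply/allP => _ /mapP[j _ ->]; exact: top.
  rewrite (perm_trans (permEl (perm_sort _ _)))//.
  rewrite (perm_trans (perm_map phi pe))//= perm_cons perm_sym.
  exact/permEl/perm_sort.
rewrite /= max_nth0_sorted ?sort_sorted//.
rewrite (perm_big _ (permEl (perm_sort _ _)))/= big_map /rival.
rewrite rem_filter ?enum_uniq// big_filter big_enum_cond/=.
by apply: eq_bigl => j; rewrite /= ?inE.
Qed.

Section Maximizer.
Variables (phi a : 'I_n -> R).
Hypothesis fa : feasible a.
Hypothesis amax : forall b, feasible b ->
  \sum_(j < n) phi j * b j <= \sum_(j < n) phi j * a j.

Lemma winner_top i j : a i = 1 -> phi j <= phi i.
Proof.
move=> ai; have := amax (feasible_delta j); rewrite sum_delta (bigD1 i)//= ai mulr1.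
by rewrite big1 ?addr0// => k ki; rewrite (feasible_winner fa ai ki) mulr0.
Qed.

Lemma winner_rival i : a i = 1 -> rival phi i <= phi i.
Proof.
move=> ai; apply: bigmax_le => [|j _]; last exact: winner_top.
(* Comparison with leaving the slot empty gives [0 <= phi i]. *)
have := amax feasible0; rewrite big1 => [|j _]; last by rewrite mulr0.
rewrite (bigD1 i)//= ai mulr1 big1 ?addr0// => k ki.
by rewrite (feasible_winner fa ai ki) mulr0.
Qed.

(** Giving the slot to [i] yields at most the optimum, which puts total weight at most 1 on rivals
    only, each worth at most [rival phi i]. *)
Lemma loser_rival i : a i = 0 -> phi i <= rival phi i.
Proof.
move=> ai; have := amax (feasible_delta i); rewrite sum_delta => /le_trans; apply.
apply: (@le_trans _ _ (\sum_(j < n) rival phi i * a j)).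
  apply: ler_sum => j _; have [->|ji] := eqVneq j i; first by rewrite ai !mulr0.
  by rewrite ler_wpM2r ?feasible_ge0 ?rival_ge.
by rewrite -mulr_sumr ler_piMr ?rival_ge0//; case: fa.
Qed.

Lemma winner_second_highest i : a i = 1 ->
  Num.max (second_highest phi) 0 = rival phi i.
Proof. by move=> ai; apply: second_highest_rival => j; exact: winner_top. Qed.

End Maximizer.
End Winner.

(** * VWM-PIA: threshold costs, incentives, prices and payments *)

Section VWM.
Variables (R : realType) (n : nat) (lo hi : 'I_n -> R) (C dens lam : 'I_n -> R -> R).
Variables (pbar : 'I_n -> R) (alloc : ('I_n -> R) -> ('I_n -> R) -> 'I_n -> R).
Hypothesis lam01 : forall i p, 0 < lam i p <= 1.
Hypothesis lam_max : forall i p, lam i p <= lam i (pbar i).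
Hypothesis reg : forall i, regular lo hi lam C dens i.
Hypothesis inj : forall i, {in `[lo i, hi i] &,
  injective (fun z => vvalue lam C dens i z (pbar i))}.
Hypothesis vwm : vwm_allocation lo hi lam C dens pbar alloc.

Let phi i z := vvalue lam C dens i z (pbar i).
Let M (c : 'I_n -> R) i := rival (fun j => phi j (c j)) i.
Let zstar c i := vv_inv lo hi lam C dens i (pbar i) (M c i).
Let pay := vwm_payment lo hi lam C dens pbar alloc.

Lemma vvalue_strict i x y : lo i <= x -> x < y -> y <= hi i -> phi i y < phi i x.
Proof.
move=> lx xy yh; rewrite lt_neqAle; apply/andP; split; last exact/reg/yh/ltW.
apply/eqP => e.
have /inj : y \in `[lo i, hi i] by rewrite in_itv/= yh (le_trans lx (ltW xy)).
have xb : x \in `[lo i, hi i] by rewrite in_itv/= lx (le_trans (ltW xy)).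
by move=> /(_ x xb e) yx; rewrite yx ltxx in xy.
Qed.

Lemma alloc01 c p i : alloc c p i = 0 \/ alloc c p i = 1.
Proof. by case: vwm => /(_ c p) [+ _] _; exact. Qed.

Lemma alloc1_ge c p i : in_costs lo hi c -> alloc c p i = 1 -> M c i <= phi i (c i).
Proof.
case: vwm => fa am cb /(winner_rival (fa c p) (am c p cb)); exact.
Qed.

Lemma alloc0_le c p i : in_costs lo hi c -> alloc c p i = 0 -> phi i (c i) <= M c i.
Proof.
case: vwm => fa am cb /(loser_rival (fa c p) (am c p cb)); exact.
Qed.

Lemma M_upd c i z : M (upd c i z) i = M c i.
Proof. by apply: eq_rival => j ji; rewrite upd_neq. Qed.

Lemma zstar_upd c i z : zstar (upd c i z) i = zstar c i.
Proof. by rewrite /zstar M_upd. Qed.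

Lemma zstar_ge c i x : lo i <= x <= hi i -> M c i <= phi i x -> x <= zstar c i.
Proof.
by move=> xb Mx; apply: ub_le_sup => //; exists (hi i) => z [/andP[]].
Qed.

(** Strict monotonicity makes [x] an upper bound of the set defining the supremum; [y] shows that
    this set is nonempty, so that [sup] is not its default value. *)
Lemma zstar_le c i x y : lo i <= x <= hi i -> phi i x <= M c i ->
  lo i <= y <= hi i -> M c i <= phi i y -> zstar c i <= x.
Proof.
move=> /andP[lx xh] xM yb My; apply: ge_sup; first by exists y.
move=> z [/andP[lz zh] Mz]; rewrite leNgt; apply/negP => xz.
by have := vvalue_strict lx xz zh; rewrite ltNge (le_trans xM).
Qed.

(** The payment is a value at the same price with [zstar] in place of the cost, so a difference of
    two values remains. The true cost [ci] is kept apart from the report [c i] to cover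
    misreports. *)
Lemma utility_zstar i ci c p : in_costs lo hi c ->
  utility lam alloc pay i ci c p = alloc c p i * (zstar c i - ci) * lam i (p i).
Proof.
move=> cb; rewrite /utility /pay /vwm_payment.
have [->|a1] := alloc01 c p i; first by rewrite !(mul0r, mulr0) subrr.
case: vwm => fa am; rewrite (winner_second_highest (fa c p) (am c p cb) a1).
by rewrite -/(phi _ _) -/(M c i) -/(zstar c i) a1 /value; ring.
Qed.

Lemma alloc1_zstar i c p : in_costs lo hi c -> alloc c p i = 1 -> c i <= zstar c i.
Proof. by move=> cb a1; apply: zstar_ge => //; exact: alloc1_ge a1. Qed.

(** The winning report [x] supplies a point of the set defining [zstar]. It may win at another price
    profile [q], since the virtual values are taken at [pbar] throughout. *)
Lemma alloc0_zstar i c p q x : in_costs lo hi c -> lo i <= x <= hi i ->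
  alloc c p i = 0 -> alloc (upd c i x) q i = 1 -> zstar c i <= c i.
Proof.
move=> cb xb a0 a1; apply: (@zstar_le _ _ _ x) => //; first exact: alloc0_le a0.
by have := alloc1_ge (in_costs_upd cb xb) a1; rewrite M_upd upd_same.
Qed.

Lemma vwm_IC : IC lo hi lam alloc pay.
Proof.
move=> i c p x cb xb; have cxb := in_costs_upd cb xb.
rewrite !utility_zstar// zstar_upd ler_pM2r; last by case/andP: (lam01 i (p i)).
(* Up to the cancelled factor [lam], losing is worth 0 and winning is worth [zstar - c i], whichever
   report wins; its sign settles the mixed cases. *)
have [a0|a1] := alloc01 c p i; have [b0|b1] := alloc01 (upd c i x) p i.
- by rewrite a0 b0.
- by rewrite a0 b1 mul0r mul1r subr_le0 (alloc0_zstar cb xb a0 b1).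
- by rewrite a1 b0 mul0r mul1r subr_ge0 (alloc1_zstar cb a1).
- by rewrite a1 b1.
Qed.

Lemma vwm_IR : IR lo hi lam alloc pay.
Proof.
move=> i c p cb; rewrite utility_zstar//.
rewrite mulr_ge0 ?(ltW (andP (lam01 _ _)).1)//.
have [->|a1] := alloc01 c p i; first by rewrite mul0r.
by rewrite a1 mul1r subr_ge0 (alloc1_zstar cb a1).
Qed.

(** The margin [zstar - c i] does not depend on prices, and when earned it is scaled by a conversion
    rate that is largest at [pbar i]. *)
Lemma vwm_dominant_prices : dominant_prices lo hi lam alloc pay pbar.
Proof.
move=> i c p q cb; rewrite !utility_zstar// !upd_same.
have l0 x : 0 <= lam i x by case/andP: (lam01 i x) => /ltW.
have [a0|a1] := alloc01 c (upd p i q) i;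
  have [b0|b1] := alloc01 c (upd p i (pbar i)) i.
- by rewrite a0 b0 !mul0r.
- by rewrite a0 b1 !mul0r mul1r mulr_ge0// subr_ge0 (alloc1_zstar cb b1).
(* Losing at [pbar i] but winning at [q] forces [zstar <= c i], so the win at [q] is worth at most
   0. *)
- rewrite a1 b0 !mul0r mul1r mulr_le0_ge0// subr_le0.
  by apply: (alloc0_zstar cb (cb i) b0 (q := upd p i q)); rewrite upd_id.
- by rewrite a1 b1 !mul1r ler_wpM2l// subr_ge0 (alloc1_zstar cb b1).
Qed.

Lemma vwm_payment_rule : payment_rule lo hi lam alloc pay.
Proof.
move=> i c p cb.
suff I : \int[lebesgue_measure]_(z in `[c i, hi i]) alloc (upd c i z) p i =
    alloc c p i * (zstar c i - c i).
  by have := utility_zstar i (c i) p cb; rewrite I /utility => e; lra.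
have zb z : z \in `[c i, hi i] -> lo i <= z <= hi i.
  rewrite in_itv/= => /andP[cz ->]; rewrite andbT.
  by apply: le_trans cz; case/andP: (cb i).
(* A winning report in this range makes the set behind [zstar] nonempty; if there is none, the
   integral and [alloc c p i] both vanish. *)
have [[z0 [z0b A0]]|none] :=
    pselect (exists z, z \in `[c i, hi i] /\ alloc (upd c i z) p i = 1); last first.
  have A0 z : z \in `[c i, hi i] -> alloc (upd c i z) p i = 0.
    by move=> zc; case: (alloc01 (upd c i z) p i) => // a1; case: none; exists z.
  rewrite (_ : alloc c p i = 0) ?mul0r; last first.
    by rewrite -(upd_id c i) A0// bound_itvE; case/andP: (cb i).
  by rewrite /Rintegral integral0_eq// => z /A0 ->.
have cz0 : c i <= zstar c i.
  have := alloc1_zstar (in_costs_upd cb (zb _ z0b)) A0.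
  rewrite zstar_upd upd_same; apply: le_trans.
  by move: z0b; rewrite in_itv/= => /andP[].
have zh : zstar c i <= hi i.
  apply: ge_sup; last by move=> z [/andP[]].
  exists z0; split; first exact: zb.
  by have := alloc1_ge (in_costs_upd cb (zb _ z0b)) A0; rewrite M_upd upd_same.
(* [b] tells whether the tie at [zstar] is won, hence whether the interval [E] is closed or open at
   its right end. *)
pose b := alloc (upd c i (zstar c i)) p i == 1.
pose E := [set` Interval (BLeft (c i)) (BSide (~~ b) (zstar c i))].
have AE z : z \in `[c i, hi i] -> alloc (upd c i z) p i = \1_E z.
  move=> zc; have zb' := zb z zc; have cxb := in_costs_upd cb zb'.
  move: zc; rewrite in_itv/= => /andP[cz _].
  have -> : \1_E z = ((if b then z <= zstar c i else z < zstar c i) : bool)%:R :> R.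
    rewrite indicE; congr (_%:R); rewrite /E mem_setE in_itv/= cz /=.
    by case: (b).
  have [zz|zz|->] := ltgtP z (zstar c i); rewrite ?if_same.
  - have [a0|->//] := alloc01 (upd c i z) p i.
    have := @alloc0_zstar _ _ _ p _ cxb (zb _ z0b) a0.
    by rewrite upd_upd zstar_upd upd_same => /(_ A0); rewrite leNgt zz.
  - have [->//|a1] := alloc01 (upd c i z) p i.
    by have := alloc1_zstar cxb a1; rewrite zstar_upd upd_same leNgt zz.
  - rewrite /b; case: eqP => [->//|].
    by case: (alloc01 (upd c i (zstar c i)) p i).
transitivity (\int[lebesgue_measure]_(z in `[c i, hi i]) (\1_E z : R)).
  by apply: eq_Rintegral => z; rewrite mem_setE => /AE.
rewrite /Rintegral integral_indic//; last exact: measurable_itv.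
rewrite (_ : E `&` _ = E); last first.
  apply/setIidl.
  move=> z; rewrite /E /= !in_itv/= => /andP[-> /=].
  by case: (b) => /= [|/ltW] /le_trans; apply.
rewrite /= /E lebesgue_measure_itv/= lte_fin.
have [a0|->] := alloc01 c p i; last first.
  by rewrite mul1r; case: ltgtP cz0 => // ->; rewrite subrr.
(* [c i] loses while some [z0 >= c i] wins, which is possible only at the tie [c i = zstar]; the
   interval then has length 0. *)
have -> : zstar c i = c i.
  by apply/le_anti; rewrite cz0 andbT (alloc0_zstar cb (zb _ z0b) a0 A0).
by rewrite ltxx subrr mulr0.
Qed.

End VWM.

(** * Integrals over a set of full measure *)

Section NullSet.
Context d (T : measurableType d) (R : realType) (mu : {measure set T -> \bar R}).
Local Open Scope ereal_scope.
Import HBNNSimple.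

(* No measurability of [f]: the payments are unconstrained outside the support of the costs. *)
Lemma integral_conull (D : set T) (f : T -> \bar R) :
  measurable D -> mu (~` D) = 0 -> \int[mu]_x f x = \int[mu]_(x in D) f x.
Proof.
move=> mD D0.
suff ge0 (g : T -> \bar R) : (forall x, 0 <= g x) ->
    \int[mu]_x g x = \int[mu]_(x in D) g x.
  by rewrite integralE [RHS]integralE !ge0.
move=> g0; rewrite ge0_integralTE// ge0_integralE//.
apply/eqP; rewrite eq_le; apply/andP; split; apply: ge_ereal_sup => _ [h /= hg <-].
  (* A simple function below [g] is cut down to [D]; its integral does not change, since the
     complement of [D] is null. *)
  apply: ereal_sup_ubound; exists (proj_nnsfun h mD) => [x|].
    by rewrite -mrestrict !patchE; case: ifP.
  have -> : sintegral mu h = \int[mu]_x (h x)%:E by rewrite integral_nnsfun// patch_setT.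
  rewrite -mrestrict -integral_nnsfun//.
  rewrite [RHS](ge0_negligible_integral (measurableC mD))//.
  - by rewrite setTD setCK.
  - exact/measurable_EFinP.
  - by move=> x _; rewrite lee_fin.
apply: ereal_sup_ubound; exists h => //= x; apply: le_trans (hg x) _.
by rewrite patchE; case: ifP.
Qed.
End NullSet.

(** * Probability measures on the line given by a density *)

Section Density.
Context (R : realType).
Variables (mu : probability (measurableTypeR R) R) (f : R -> R).
Local Open Scope ereal_scope.
Hypothesis mf : measurable_fun setT f.
Hypothesis f0 : forall x, (0 <= f x)%R.
Hypothesis muf : forall x, mu `]-oo, x]%classic =
  \int[lebesgue_measure]_(z in `]-oo, x]) (f z)%:E.

Let nu (A : set (measurableTypeR R)) : \bar R := \int[lebesgue_measure]_(z in A) (f z)%:E.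

Let nu0 : nu set0 = 0.
Proof. by rewrite /nu integral_set0. Qed.

Let nu_ge0 A : 0 <= nu A.
Proof. by apply: integral_ge0 => x _; rewrite lee_fin. Qed.

Let nu_sigma_additive : semi_sigma_additive nu.
Proof.
move=> F mF tF mUF; rewrite /nu; apply: cvg_toP.
  apply: ereal_nondecreasing_is_cvgn => m n mn.
  by apply: lee_sum_nneg_natr => // k _ _; exact: nu_ge0.
rewrite ge0_integral_bigcup//=; first exact/measurable_funTS/measurable_EFinP.
by move=> x _; rewrite lee_fin.
Qed.

HB.instance Definition _ := isMeasure.Build _ _ _ nu nu0 nu_ge0 nu_sigma_additive.

(** The intervals []a, b]] are stable under intersection and generate the Borel sets, and on each of
    them both measures are the same difference of two values on half-lines. *)
Lemma density_measure A : measurable A -> mu A = \int[lebesgue_measure]_(z in A) (f z)%:E.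
Proof.
move=> mA; rewrite -/(nu A).
have fin x : nu `]-oo, x]%classic < +oo.
  by rewrite /nu -muf; apply: le_lt_trans (probability_le1 _ _) _; rewrite ?ltry.
apply: (@measure_unique _ R (measurableTypeR R) (@ocitv R) (fun n => `](- n%:R)%R, n%:R]%classic)) => //.
- exact: ocitvI.
- by move=> i; exact: is_ocitv.
- rewrite -subTset => x _; exists (Num.truncn `|x|).+1 => //=.
  have := truncnS_gt `|x|; rewrite in_itv/= ltr_norml => /andP[-> /ltW ->] //.
- move=> _ [[a b] /= _ <-]; have [ba|ab] := leP b a.
    by rewrite set_itv_ge ?measure0// bnd_simp -leNgt.
  have -> : `]a, b]%classic = `]-oo, b] `\` `]-oo, a] :> set R.
    by rewrite -[RHS]setCK setCD setCitvl setUC -[LHS]setCK setCitv.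
  have sub : (`]-oo, a] : set R) `<=` `]-oo, b] by apply: subset_itvl; rewrite bnd_simp ltW.
  have mE x : measurable (`]-oo, x]%classic : set (measurableTypeR R)) by exact: measurable_itv.
  rewrite !measureD ?setIidr//; first by congr (_ - _); exact: muf.
  by rewrite -ge0_fin_numE ?fin_num_measure.
- move=> k; apply: le_lt_trans (probability_le1 _ _) _ => //; exact: ltry.
Qed.

(** The Radon-Nikodym derivative of [mu] has the same integral as [f] over every measurable set,
    hence equals [f] almost everywhere. *)
Lemma ge0_integral_density (g : R -> \bar R) :
  measurable_fun setT g -> (forall x, 0 <= g x) ->
  \int[mu]_x g x = \int[lebesgue_measure]_x (g x * (f x)%:E).
Proof.
move=> mg g0.
have muleb : mu `<< (@lebesgue_measure R).
  apply/null_content_dominatesP => A mA A0; rewrite density_measure//.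
  rewrite null_set_integral//; exact/measurable_funTS/measurable_EFinP.
rewrite -(Radon_Nikodym_SigmaFinite.change_of_variables muleb)//.
apply: ae_eq_integral => //.
- apply: emeasurable_funM => //; apply: measurable_int.
  exact: Radon_Nikodym_SigmaFinite.f_integrable.
- by apply: emeasurable_funM => //; exact/measurable_EFinP.
have : ae_eq lebesgue_measure setT (Radon_Nikodym_SigmaFinite.f mu (@lebesgue_measure R))
    (EFin \o f).
  apply: integral_ae_eq => //.
  - exact: Radon_Nikodym_SigmaFinite.f_integrable.
  - exact/measurable_EFinP.
  - move=> E _ mE; rewrite -density_measure//.
    by rewrite -Radon_Nikodym_SigmaFinite.f_integral.
by apply: filterS => x /= /[apply] ->.
Qed.
End Density.

(** * The measurable space of profiles, and resampling one of several independent costs *)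

HB.instance Definition _ (R : realType) n := gen_eqMixin (profile R n).
HB.instance Definition _ (R : realType) n := gen_choiceMixin (profile R n).
HB.instance Definition _ (R : realType) n := isPointed.Build (profile R n) (fun=> 0).

Section Resampling.
Context (R : realType) (n : nat) d (T : measurableType d) (P : probability T R).
Variable c : 'I_n -> T -> R.
Hypothesis mc : forall i, measurable_fun setT (c i).
Hypothesis ic : indep_costs P c.
Local Notation Prof := (g_sigma_algebraType (@cylinders R n)).

Lemma measurable_fun_profile d' (T' : measurableType d') (X : T' -> 'I_n -> R) :
  (forall i, measurable_fun setT (X ^~ i)) ->
  measurable_fun setT (X : T' -> Prof).
Proof.
move=> mX; apply: (@measurability _ _ T' Prof setT X (@cylinders R n)) => // _ [_ [B [mB ->]] <-].
rewrite setTI (_ : _ @^-1` _ = \bigcap_(i in [set: 'I_n]) (X ^~ i @^-1` B i)).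
  apply: fin_bigcap_measurable => // i _; rewrite -[X in measurable X]setTI.
  by apply: mX => //; exact: mB.
by apply/seteqP; split=> [x /= H i _|x /= H i]; apply: H.
Qed.

Lemma measurable_coord i : measurable_fun setT (fun x : Prof => x i).
Proof.
move=> _ B mB; rewrite setTI; apply: sub_sigma_algebra.
exists (fun j => if j == i then B else setT); split.
  by move=> j; case: ifP => // _; exact: measurableT.
by apply/seteqP; split=> [x /= Bx j|x /= /(_ i)]; rewrite ?eqxx//; case: eqP => // ->.
Qed.

Lemma measurable_upd i : measurable_fun setT (fun xz : Prof * R => upd xz.1 i xz.2 : Prof).
Proof.
apply: measurable_fun_profile => j; rewrite /upd; case: eqP => _.
  exact: measurable_snd.
exact: (measurableT_comp (measurable_coord j) measurable_fst).
Qed.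

Definition law_mfun i : {mfun T >-> measurableTypeR R} :=
  HB.pack (c i) (isMeasurableFun.Build _ _ T (measurableTypeR R) (c i) (mc i)).

Definition law i : probability (measurableTypeR R) R := distribution P (law_mfun i).

Let mupd i : measurable_fun setT
  (fun wz : T * measurableTypeR R => upd (fun j => c j wz.1) i wz.2 : Prof).
Proof.
apply: measurable_fun_profile => j; rewrite /upd; case: eqP => _.
  exact: measurable_snd.
exact: (measurableT_comp (mc j) measurable_fst).
Qed.

Let joint : T -> Prof := fun w j => c j w.
Let mjoint : measurable_fun setT joint := measurable_fun_profile mc.
Let jointX : {mfun T >-> Prof} := HB.pack joint (isMeasurableFun.Build _ _ _ _ joint mjoint).
Let updX i : {mfun (T * measurableTypeR R)%type >-> Prof} :=
  HB.pack (fun wz : T * measurableTypeR R => upd (fun j => c j wz.1) i wz.2 : Prof)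
    (isMeasurableFun.Build _ _ _ _ _ (mupd i)).

Local Open Scope ereal_scope.

(** Cylinders are stable under intersection and generate the sigma-algebra, so the laws need only be
    compared there. Resampling turns the preimage of a cylinder into a rectangle, and independence
    factors both sides into the same product. *)
Lemma joint_law_resample i A : measurable (A : set Prof) ->
  distribution P jointX A = distribution (P \x law i) (updX i) A.
Proof.
apply: (@measure_unique _ R Prof (@cylinders R n) (fun=> setT)) => //.
- move=> _ _ [B [mB ->]] [B' [mB' ->]]; exists (fun j => B j `&` B' j); split.
    by move=> j; exact: measurableI.
  by apply/seteqP; split=> [x /= [? ?] //|x /= H]; split => j; case: (H j).
- move=> _; exists (fun=> setT); split => //.
  by apply/seteqP; split.
- by rewrite bigcup_const//; exists 0%N.
- move=> _ [B [mB ->]]; 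
  pose S := [set x : 'I_n -> R | forall j, B j (x j)].
  change (P (joint @^-1` S) = (P \x law i)
    ((fun wz : T * R => upd (fun j => c j wz.1) i wz.2) @^-1` S)).
  (* Dropping the constraint on coordinate [i] lets independence be applied to the other coordinates
     alone. *)
  pose B' j := if j == i then setT else B j.
  have mB' j : measurable (B' j) by rewrite /B'; case: ifP.
  have -> : (fun wz : T * R => upd (fun j => c j wz.1) i wz.2) @^-1` S =
    (\bigcap_(j in [set: 'I_n]) (c j @^-1` B' j)) `*` B i.
    apply/seteqP; split=> [[w z] /= H|[w z] /= [H Bz] j].
      split; last by have := H i; rewrite upd_same.
      by move=> j _; rewrite /B'; case: eqVneq => //= ji; have := H j; rewrite upd_neq.
    rewrite /upd; case: eqVneq => [-> //|ji].
    by have := H j I; rewrite /B' (negbTE ji).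
  rewrite product_measure1E; last 2 first; [|exact: mB|].
    apply: fin_bigcap_measurable => // j _; rewrite -[X in measurable X]setTI.
    exact: mc.
  transitivity ((\prod_(j < n) P (c j @^-1` B' j)) * P (c i @^-1` B i)); last first.
    by rewrite -(ic mB').
  have -> : joint @^-1` S = 
    \bigcap_(j in [set: 'I_n]) (c j @^-1` B j).
    by apply/seteqP; split=> [x /= H j _|x /= H j]; apply: H.
  rewrite (ic mB) (bigD1 i)//= [in RHS](bigD1 i)//=.
  rewrite (_ : B' i = setT) ?preimage_setT; last by rewrite /B' eqxx.
  rewrite probability_setT mul1e.
  rewrite muleC; congr (_ * _); apply: eq_bigr => j ji.
  by rewrite /B' (negbTE ji).
- by move=> k; apply: le_lt_trans (probability_le1 _ _) _; rewrite ?ltry.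
Qed.

Lemma ge0_integral_resample i (G : Prof -> \bar R) :
  measurable_fun setT G -> (forall x, 0 <= G x) ->
  \int[P]_w G (fun j => c j w) = \int[P]_w \int[law i]_z G (upd (fun j => c j w) i z).
Proof.
move=> mG G0.
rewrite -(ge0_integral_distribution jointX)//.
rewrite (eq_measure_integral (distribution (P \x law i) (updX i))); last first.
  by move=> A mA _; exact: joint_law_resample.
rewrite ge0_integral_distribution// fubini_tonelli1//; last by move=> x; exact: G0.
exact: measurableT_comp (mupd i).
Qed.

End Resampling.

(** * Expected information rent of one advertiser *)

Section InformationRent.
Context (R : realType) (n : nat) d (T : measurableType d) (P : probability T R).
Variable c : 'I_n -> T -> R.
Hypothesis mc : forall i, measurable_fun setT (c i).
Hypothesis ic : indep_costs P c.
Local Notation Prof := (g_sigma_algebraType (@cylinders R n)).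
Variables (i : 'I_n) (F f h : R -> R) (hi : R) (a : Prof -> R).
Hypothesis cdfF : forall x, P [set w | c i w <= x] = (F x)%:E.
Hypothesis mf : measurable_fun setT f.
Hypothesis f0 : forall x, 0 <= f x.
Hypothesis densf : forall x,
  ((F x)%:E = \int[lebesgue_measure]_(z in `]-oo, x]) (f z)%:E)%E.
Hypothesis mh : measurable_fun setT h.
Hypothesis h0 : forall x, 0 <= h x.
Hypothesis hf : forall z, h z * f z = if z <= hi then F z else 0.
Hypothesis ma : measurable_fun setT a.
Hypothesis a0 : forall x, 0 <= a x.
Local Open Scope ereal_scope.

Let cw w : Prof := fun j => c j w.

Let lawE x : law P mc i `]-oo, x]%classic = (F x)%:E.
Proof.
by rewrite -cdfF.
Qed.

Let law_density (g : R -> \bar R) : measurable_fun setT g -> (forall x, 0 <= g x) ->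
  \int[law P mc i]_z g z = \int[lebesgue_measure]_z (g z * (f z)%:E).
Proof. by apply: ge0_integral_density => // x; rewrite lawE densf. Qed.

(** Moving the range of integration into the integrand makes the rent an integral over the whole
    line of one jointly measurable function, as Tonelli's theorem requires. *)
Let K (xz : Prof * measurableTypeR R) : \bar R :=
  if ((xz.1 i <= xz.2) && (xz.2 <= hi))%R then (a (upd xz.1 i xz.2))%:E else 0.

Let mK : measurable_fun setT K.
Proof.
apply: measurable_fun_ifT => //.
  apply: measurable_and.
    apply: measurable_fun_ler; last exact: measurable_snd.
    exact: (measurableT_comp (@measurable_coord R n i) measurable_fst).
  by apply: measurable_fun_ler => //; exact: measurable_snd.
apply/measurable_EFinP.
exact: (measurableT_comp ma (@measurable_upd R n i)).
Qed.

Let K0 xz : 0 <= K xz.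
Proof. by rewrite /K; case: ifP; rewrite ?lee_fin. Qed.

Definition rent (x : Prof) : \bar R :=
  \int[lebesgue_measure]_(z in `[x i, hi]) (a (upd x i z))%:E.

Let rentE x : rent x = \int[lebesgue_measure]_z K (x, z).
Proof.
rewrite /rent integral_mkcond; apply: eq_integral => z _.
by rewrite patchE mem_setE in_itv.
Qed.

Lemma measurable_rent : measurable_fun setT rent.
Proof.
rewrite (_ : rent = fubini_F lebesgue_measure K); last exact/funext.
exact: measurable_fun_fubini_tonelli_F.
Qed.

Lemma rent_ge0 x : 0 <= rent x.
Proof. by apply: integral_ge0 => z _; rewrite lee_fin. Qed.

(** Once [c i] is resampled, the rent becomes a double integral over a cost [y] and a point [z] with
    [y <= z <= hi]. Integrating [y] first gives the allocation at [z] times [F z], which is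
    [h z * f z] on that range; [h] thus acts as C_i / C_i'. *)
Lemma expected_rent :
  \int[P]_w rent (cw w) = \int[P]_w (a (cw w) * h (c i w))%:E.
Proof.
have mah : measurable_fun setT (fun x : Prof => (a x * h (x i))%:E).
  apply/measurable_EFinP; apply: measurable_funM => //.
  exact: (measurableT_comp mh (@measurable_coord R n i)).
have ah0 (x : Prof) : 0 <= (a x * h (x i))%:E by rewrite lee_fin mulr_ge0.
rewrite (ge0_integral_resample mc ic i measurable_rent rent_ge0).
rewrite (ge0_integral_resample mc ic i mah ah0).
apply: eq_integral => w _.
have mau : measurable_fun setT (fun z : measurableTypeR R => a (upd (cw w) i z)).
  apply: (measurableT_comp ma).
  exact: (measurable_fun_pair2 _ (@measurable_upd R n i)).
transitivity (\int[lebesgue_measure]_z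
    ((a (upd (cw w) i z))%:E * (if z <= hi then F z else 0)%R%:E)); last first.
  rewrite [RHS](law_density (g := fun z => (a (upd (cw w) i z) * h (upd (cw w) i z i))%:E))//.
  - by apply: eq_integral => z _; rewrite -hf upd_same -!EFinM mulrA.
  - apply/measurable_EFinP; apply: measurable_funM => //.
    by under eq_fun do rewrite upd_same.
under eq_integral => y _ do rewrite rentE.
rewrite (fubini_tonelli (fun yz : measurableTypeR R * measurableTypeR R =>
    K (upd (cw w) i yz.1, yz.2)))//=; last first.
  apply: (measurableT_comp mK); apply: measurable_fun_pair; last exact: measurable_snd.
  apply: (measurableT_comp _ measurable_fst).
  exact: (measurable_fun_pair2 _ (@measurable_upd R n i)).
apply: eq_integral => z _; rewrite /K/=.
under eq_integral => y _ do rewrite upd_same upd_upd.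
case: (leP z hi) => zh; last first.
  by rewrite mule0 integral0_eq// => y _; rewrite andbF.
(* In [y] the integrand is a constant times the indicator of []-oo, z]], whose mass under the law of
   [c i] is [F z]. *)
rewrite (eq_integral (fun y : measurableTypeR R =>
    (a (upd (cw w) i z))%:E * (\1_(`]-oo, z]%classic) y)%:E)).
  rewrite ge0_integralZl//.
  - by rewrite integral_indic// setIT; congr (_ * _); exact: lawE.
  - by apply/measurable_EFinP; apply: measurable_indic; exact: measurable_itv.
  - by rewrite lee_fin.
by move=> y _; rewrite indicE mem_setE in_itv/= andbT; case: ifP; rewrite ?mule1 ?mule0.
Qed.
End InformationRent.

(** * Expected revenue as expected virtual surplus *)

Section ExpectedRevenue.
Context (R : realType) (n : nat) (lo hi : 'I_n -> R) (C dens lam : 'I_n -> R -> R).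
Context (pbar : 'I_n -> R) d (T : measurableType d) (P : probability T R).
Variable c : 'I_n -> T -> R.
Hypothesis lam01 : forall i p, 0 < lam i p <= 1.
Hypothesis mc : forall i, measurable_fun setT (c i).
Hypothesis ic : indep_costs P c.
Hypothesis cdfC : forall i x, P [set w | c i w <= x] = (C i x)%:E.
Hypothesis densC : forall i, is_density lo hi C dens i.
Hypothesis reg : forall i, regular lo hi lam C dens i.
Local Notation Prof := (g_sigma_algebraType (@cylinders R n)).

Let cw w : Prof := fun j => c j w.

Lemma dens_ge0 i z : 0 <= dens i z.
Proof.
case: (densC i) => _ d0 d1 _; have [/d0/ltW//|] := boolP (lo i <= z <= hi i).
by rewrite negb_and -!ltNge => /orP zz; rewrite d1.
Qed.

Lemma cdf_lt_lo i z : z < lo i -> C i z = 0.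
Proof.
case: (densC i) => _ _ d1 dE zl; apply: EFin_inj; rewrite dE integral0_eq// => y.
by rewrite /= in_itv/= => yz; rewrite d1//; left; exact: le_lt_trans zl.
Qed.

Lemma cdf_ge0 i z : 0 <= C i z.
Proof. by rewrite -lee_fin -cdfC. Qed.

Lemma law_support i : P (c i @^-1` `[lo i, hi i]) = 1%E.
Proof.
case: (densC i) => mf _ d1 dE.
have S0 : P (c i @^-1` ~` `[lo i, hi i]) = 0%E.
  have mS : measurable (~` `[lo i, hi i] : set (measurableTypeR R)).
    by apply: measurableC; exact: measurable_itv.
  have lawE x : law P mc i `]-oo, x]%classic =
      (\int[lebesgue_measure]_(z in `]-oo, x]) (dens i z)%:E)%E.
    by rewrite -dE -cdfC.
  rewrite [LHS](density_measure mf (dens_ge0 i) lawE mS) integral0_eq// => y.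
  rewrite /= in_itv/= => /negP; rewrite negb_and -!ltNge => /orP yy.
  by rewrite d1.
have mI : measurable (c i @^-1` `[lo i, hi i]).
  by rewrite -[X in measurable X]setTI; apply: mc.
rewrite -[X in P X]setCK probability_setC ?preimage_setC ?S0 ?sube0//.
by rewrite -preimage_setC; exact: measurableC.
Qed.

Definition box : set T := [set w | in_costs lo hi (cw w)].

Let boxE : box = \bigcap_(i in [set: 'I_n]) (c i @^-1` `[lo i, hi i]).
Proof.
apply/seteqP; split=> w /= H i; first by move=> _; rewrite /= in_itv/=; exact: H.
by have := H i I; rewrite /= in_itv.
Qed.

Lemma measurable_box : measurable box.
Proof.
rewrite boxE; apply: fin_bigcap_measurable => // i _.
by rewrite -[X in measurable X]setTI; apply: mc.
Qed.

Lemma prob_box : P box = 1%E.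
Proof. by rewrite boxE ic// big1// => i _; rewrite law_support. Qed.

Lemma prob_boxC : P (~` box) = 0%E.
Proof. by rewrite probability_setC ?prob_box ?subee//; exact: measurable_box. Qed.

(** An event of probability 1 is nonempty, and any point of [box] has its costs between the
    bounds. *)
Lemma lo_le_hi i : lo i <= hi i.
Proof.
have [w wb] : box !=set0.
  apply/set0P/negP => /eqP b0; have := prob_box; rewrite b0 measure0 => /eqP.
  by rewrite eqe eq_sym oner_eq0.
by case/andP: (wb i) => /le_trans; apply.
Qed.

Section OneBidder.
Variables (i : 'I_n) (a : Prof -> R).
Hypothesis ma : measurable_fun setT a.
Hypothesis a0 : forall x, 0 <= a x.
Hypothesis a1 : forall x, a x <= 1.

Let clamp z := Num.max (lo i) (Num.min z (hi i)).

Let clampP z : lo i <= clamp z <= hi i.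
Proof. by rewrite /clamp le_max lexx/= ge_max lo_le_hi ge_min lexx orbT. Qed.

Let clamp_id z : lo i <= z <= hi i -> clamp z = z.
Proof. by move=> /andP[lz zh]; rewrite /clamp min_l// max_r. Qed.

Let clamp_nd : {homo clamp : x y / x <= y}.
Proof.
move=> x y xy; rewrite /clamp ge_max le_max lexx/= le_max; apply/orP; right.
by rewrite le_min !ge_min xy lexx orbT.
Qed.

(* Clamping to the support makes the virtual value monotone on the whole line, hence [h] measurable. *)
Let h z := C i (clamp z) / dens i (clamp z).

Let mh : measurable_fun setT h.
Proof.
have l0 : lam i (pbar i) != 0 by rewrite gt_eqF//; case/andP: (lam01 i (pbar i)).
(* Solving the definition of the virtual value for C_i / C_i' leaves only terms monotone in [z]. *)
have -> : h = (fun z => pbar i - clamp z -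
    vvalue lam C dens i (clamp z) (pbar i) * (lam i (pbar i))^-1).
  apply/funext => z; rewrite /h /vvalue /value; field.
  rewrite l0 gt_eqF//=; case: (densC i) => _ d0 _ _; exact: d0.
apply: measurable_funB.
  by apply: measurable_funB => //; apply: nondecreasing_measurable.
apply: measurable_funM => //; apply: nonincreasing_measurable => // x y xy.
case/andP: (clampP x) => lx _; case/andP: (clampP y) => _ yh.
by apply: reg => //; exact: clamp_nd.
Qed.

Let h0 z : 0 <= h z.
Proof. by rewrite divr_ge0 ?cdf_ge0 ?dens_ge0. Qed.

Let hf z : h z * dens i z = if z <= hi i then C i z else 0.
Proof.
case: (densC i) => _ d0 d1 _.
have [zh|zh] := leP z (hi i); last by rewrite d1 ?mulr0//; right.
have [lz|zl] := leP (lo i) z; last by rewrite d1 ?mulr0 ?cdf_lt_lo//; left.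
by rewrite /h clamp_id ?lz// mulfVK// gt_eqF// d0// lz.
Qed.

Let u w := value lam i (c i w) (pbar i) * a (cw w).
Let J w : \bar R := rent i (hi i) a (cw w).
Let H w := a (cw w) * h (c i w).

Let mcw : measurable_fun setT cw := measurable_fun_profile mc.

Let mJ : measurable_fun setT J.
Proof. exact: (measurableT_comp (measurable_rent i (hi i) ma a0) mcw). Qed.

Let macw : measurable_fun setT (fun w => a (cw w)) := measurableT_comp ma mcw.

Let iu : P.-integrable box (EFin \o u).
Proof.
(* On [box] the cost lies between [lo i] and [hi i], so [M] bounds the margin [pbar i - c i w]; the
   other factors are at most 1. *)
pose M := `|pbar i| + `|lo i| + `|hi i|.
apply: (@le_integrable _ _ _ _ _ measurable_box _ (EFin \o cst M)).
- apply/measurable_EFinP/measurable_funTS; apply: measurable_funM => //.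
  apply: measurable_funM => //; exact: measurable_funB.
- move=> w wb /=; rewrite lee_fin /u /value !normrM.
  rewrite [`|a _|]ger0_norm// [X in _ <= X]ger0_norm ?addr_ge0//.
  have /andP[l0 l1] := lam01 i (pbar i); rewrite [`|lam _ _|]gtr0_norm//.
  apply: (@le_trans _ _ `|pbar i - c i w|).
    have la1 : lam i (pbar i) * a (cw w) <= 1 by apply: mulr_ile1 => //; exact: ltW.
    by rewrite -mulrA ler_piMr.
  rewrite (le_trans (ler_normB _ _))// /M -addrA lerD2l.
  case/andP: (wb i) => lw wh; rewrite ler_norml.
  have := ler_norm (hi i); have := normr_ge0 (lo i).
  have := normr_ge0 (hi i); rewrite /cw in lw wh *; have := ler_norm (- lo i); rewrite normrN.
  by move=> *; apply/andP; split; lra.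
- by apply: finite_measure_integrable_cst; exact: measurable_box.
Qed.

Let J_le w : box w -> (J w <= (hi i - lo i)%:E)%E.
Proof.
move=> wb; case/andP: (wb i) => lw wh.
apply: (@le_trans _ _ (\int[lebesgue_measure]_(z in `[cw w i, hi i]) cst 1%:E z)%E).
  apply: ge0_le_integral => //=.
  - by move=> z _; rewrite lee_fin.
  - apply/measurable_EFinP/measurable_funTS; apply: (measurableT_comp ma).
    exact: (measurable_fun_pair2 _ (@measurable_upd R n i)).
  - by move=> z _; rewrite lee_fin.
rewrite integral_cst//= lebesgue_measure_itv/= lte_fin mul1e.
case: ifP => _; rewrite -?EFinB lee_fin; lra.
Qed.

Let iJ : P.-integrable box J.
Proof.
apply: (@le_integrable _ _ _ _ _ measurable_box _ (EFin \o cst (hi i - lo i))).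
- exact: measurable_funTS.
- move=> w wb /=; rewrite gee0_abs; last exact: rent_ge0.
  by rewrite (le_trans (J_le wb))// lee_fin ler_norm.
- by apply: finite_measure_integrable_cst; exact: measurable_box.
Qed.

Let intJH : (\int[P]_(w in box) J w = \int[P]_(w in box) (H w)%:E)%E.
Proof.
case: (densC i) => mf _ _ dE.
have conull f := @integral_conull _ _ _ P box f measurable_box prob_boxC.
rewrite -(conull J) -(conull (EFin \o H)).
exact: (expected_rent mc ic (cdfC i) mf (dens_ge0 i) dE mh h0 hf ma a0).
Qed.

(** [H] is nonnegative with the same integral as [J], which is finite. *)
Let iH : P.-integrable box (EFin \o H).
Proof.
apply/integrableP; split.
  apply/measurable_EFinP/measurable_funTS; apply: measurable_funM => //.
  exact: measurableT_comp.
under eq_integral => w _.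
  rewrite gee0_abs; last by rewrite lee_fin mulr_ge0.
  over.
by rewrite -intJH ltey_eq integrable_fin_num//; exact: measurable_box.
Qed.

(** On [box], both integrands are [u] minus [l] times a term, [J] for the payment and [H] for the
    virtual value, and [intJH] equates the integrals of these terms. *)
Lemma expected_virtual_value (l := lam i (pbar i)) :
  let q w := value lam i (c i w) (pbar i) * a (cw w) - l * fine (rent i (hi i) a (cw w)) in
  let r w := vvalue lam C dens i (c i w) (pbar i) * a (cw w) in
  [/\ P.-integrable box (EFin \o q), P.-integrable box (EFin \o r) &
   (\int[P]_(w in box) (q w)%:E = \int[P]_(w in box) (r w)%:E)%E].
Proof.
move=> q r; have mB := measurable_box.
have qE : {in box, ((EFin \o u) \- (fun w => l%:E * J w))%E =1 EFin \o q}.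
  move=> w /[!inE] wb; rewrite /= /q EFinB [(l * _)%:E]EFinM fineK//.
  by rewrite ge0_fin_numE ?rent_ge0// (le_lt_trans (J_le wb))// ltry.
have rE : {in box, ((EFin \o u) \- (fun w => l%:E * (EFin \o H) w))%E =1 EFin \o r}.
  move=> w /[!inE] wb; suff rw : r w = u w - l * H w by rewrite /= rw EFinB EFinM.
  by rewrite /u /H /r /h clamp_id; [rewrite /vvalue -/l; ring|exact: wb].
have ilJ := integrableZl mB l iJ; have ilH := integrableZl mB l iH.
split.
- by apply: eq_integrable qE _ => //; exact: integrableB.
- by apply: eq_integrable rE _ => //; exact: integrableB.
- rewrite -(eq_integral _ _ qE) -(eq_integral _ _ rE).
  by rewrite !integralB// !integralZl// intJH.
Qed.

End OneBidder.

Lemma expected_revenue (alloc pay : ('I_n -> R) -> ('I_n -> R) -> 'I_n -> R) :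
  is_allocation alloc -> (forall i, prod_measurable (fun x => alloc x pbar i)) ->
  payment_rule lo hi lam alloc pay ->
  let r w := \sum_(i < n) vvalue lam C dens i (c i w) (pbar i) * alloc (cw w) pbar i in
  P.-integrable box (EFin \o r) /\
  (exp_revenue P c pay pbar = \int[P]_(w in box) (r w)%:E)%E.
Proof.
move=> fa ma pr r; have mB := measurable_box.
have ma' i : measurable_fun setT ((fun x => alloc x pbar i) : Prof -> R).
  by move=> _ A mA; rewrite setTI; exact: ma.
have ev i := expected_virtual_value i (ma' i)
  (fun x => feasible_ge0 i (fa x pbar)) (fun x => feasible_le1 i (fa x pbar)).
have rE w : (r w)%:E = (\sum_(i < n)
    (vvalue lam C dens i (c i w) (pbar i) * alloc (cw w) pbar i)%:E)%E.
  by rewrite sumEFin.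
split.
  rewrite (_ : EFin \o r = fun w => (\sum_(i < n)
    (vvalue lam C dens i (c i w) (pbar i) * alloc (cw w) pbar i)%:E)%E); last exact/funext.
  by apply: integrable_sum => // i _; case: (ev i).
(* The payment rule is known only on [box], and its complement is null. *)
rewrite /exp_revenue (integral_conull _ mB prob_boxC).
under [RHS]eq_integral do rewrite rE.
rewrite [RHS]integral_sum//; last by move=> i; case: (ev i).
transitivity (\int[P]_(w in box) (\sum_(i < n)
    (value lam i (c i w) (pbar i) * alloc (cw w) pbar i -
     lam i (pbar i) * fine (rent i (hi i) (fun x => alloc x pbar i) (cw w)))%:E))%E.
  apply: eq_integral => w /[!inE] wb; rewrite sumEFin; congr EFin.
  by apply: eq_bigr => i _; rewrite (pr i (cw w) pbar wb).
rewrite integral_sum//; last by move=> i; case: (ev i).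
by apply: eq_bigr => i _; case: (ev i).
Qed.

End ExpectedRevenue.

(** The payment rule leaves a utility of [lam i (p i)] times an integral of the allocation, which is
    nonnegative and, by price independence, the same at all prices. *)
Lemma payment_rule_dominant_prices (R : realType) (n : nat)
    (lo hi : 'I_n -> R) (lam : 'I_n -> R -> R) (pbar : 'I_n -> R)
    (alloc pay : ('I_n -> R) -> ('I_n -> R) -> 'I_n -> R) :
  (forall i p, lam i p <= lam i (pbar i)) -> is_allocation alloc ->
  price_independent alloc -> payment_rule lo hi lam alloc pay ->
  dominant_prices lo hi lam alloc pay pbar.
Proof.
move=> lam_max fa pind pr i c p q cb.
pose I x := \int[lebesgue_measure]_(z in `[c i, hi i]) alloc (upd c i z) x i.
have uE x : utility lam alloc pay i (c i) c x = lam i (x i) * I x.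
  by rewrite /utility pr// opprB addrC subrK.
have IE x y : I x = I y by apply: eq_Rintegral => z _; exact: pind.
rewrite !uE !upd_same (IE _ (upd p i q)) ler_wpM2r//.
by apply: Rintegral_ge0 => z _; exact: feasible_ge0.
Qed.

Theorem theorem5 (R : realType) (n : nat)
  (lo hi : 'I_n -> R) (C dens lam : 'I_n -> R -> R) (pbar : 'I_n -> R)
  (d : measure_display) (T : measurableType d) (P : probability T R)
  (c : 'I_n -> T -> R) (allocV : ('I_n -> R) -> ('I_n -> R) -> 'I_n -> R) :
  (* conversion rates in (0,1], pbar_i in argmax lambda_i *)
  (forall i p, 0 < lam i p <= 1) ->
  (forall i p, lam i p <= lam i (pbar i)) ->
  (* independent costs c_i with CDF C_i and density C_i' = dens_i *)
  (forall i, measurable_fun setT (c i)) ->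
  indep_costs P c ->
  (forall i x, P [set w | c i w <= x] = (C i x)%:E) ->
  (forall i, is_density lo hi C dens i) ->
  (* regularity, and invertibility of c |-> phi_i(c, pbar_i) *)
  (forall i, regular lo hi lam C dens i) ->
  (forall i, {in `[lo i, hi i] &,
     injective (fun z => vvalue lam C dens i z (pbar i))}) ->
  (* VWM-PIA allocation (measurable tie-breaking) *)
  vwm_allocation lo hi lam C dens pbar allocV ->
  (forall i, prod_measurable (fun c' => allocV c' pbar i)) ->
  let payV := vwm_payment lo hi lam C dens pbar allocV in
  [/\ IC lo hi lam allocV payV,
      IR lo hi lam allocV payV,
      dominant_prices lo hi lam allocV payV pbar &
      forall alloc pay : ('I_n -> R) -> ('I_n -> R) -> 'I_n -> R,
        is_allocation alloc ->
        IC lo hi lam alloc pay -> IR lo hi lam alloc pay ->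
        price_independent alloc ->
        payment_rule lo hi lam alloc pay ->
        (forall i, prod_measurable (fun c' => alloc c' pbar i)) ->
        dominant_prices lo hi lam alloc pay pbar /\
        (exp_revenue P c pay pbar <= exp_revenue P c payV pbar)%E].
Proof.
move=> lam01 lam_max mc ic cdfC densC reg inj vwm maV payV.
(* This puts VWM-PIA under the same revenue formula as its competitors. *)
have prV : payment_rule lo hi lam allocV payV by exact: vwm_payment_rule.
split; [exact: vwm_IC|exact: vwm_IR|exact: vwm_dominant_prices|].
move=> alloc pay fa _ _ pind pr ma; split; first exact: payment_rule_dominant_prices pr.
have [faV amaxV] := vwm.
have [ir ->] := expected_revenue lam01 mc ic cdfC densC reg fa ma pr.
have [irV ->] := expected_revenue lam01 mc ic cdfC densC reg faV maV prV.
(* Both revenues are now expected virtual surpluses over [box], where [allocV] is optimal among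
   feasible allocations at each cost profile. *)
apply: le_integral => //; first exact: measurable_box.
move=> w /[!inE] wb; rewrite lee_fin; exact: amaxV.
Qed.
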